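(* Fix $\epsilon^*>0$. Then there exists $c>0$ such that for all sufficiently large positive integers $k$, $$G\left(k,(1/2-\epsilon^* )k^2,k^2\right) \le \exp(-ck)\,k!.$$
   Context: $[k]=\{1,\dots,k\}$, $S_k$ is the set of permutations of $[k]$, and $[k]^*$ is the set of finite words on the alphabet $[k]$; a permutation $\tau\in S_k$ is regarded as the word $\tau(1),\dots,\tau(k)$. A DFA over $[k]$ is a triple $D=(V,\delta,\mathrm{root}(D))$ with $V$ a finite set of states, $\delta:V\times[k]\to V$ a transition function, and $\mathrm{root}(D)\in V$. For $v\in V$ and $w=w_1,\dots,w_L\in[k]^*$, the walk induced by $w$ from $v$ is $v_0,\dots,v_L$, where $v_0=v$ and $v_j=\delta(v_{j-1},w_j)$ for $1\le j\le L$. A weighted DFA is a DFA together with a function $\mathrm{cost}:V\times[k]\to\{1,2,3,\dots\}\cup\{\infty\}$, extended to $V\times[k]^*$ by $\mathrm{cost}(v,w)=\sum_{j=1}^{L}\mathrm{cost}(v_{j-1},w_j)$, where $v_0,\dots,v_L$ is the walk induced by $w$ from $v$. A $k$-DFA is a weighted DFA over $[k]$ such that for each state $v$ there is a permutation $\pi_v\in S_k$ with $\mathrm{cost}(v,t)=\pi_v(t)$ for all $t\in[k]$. For a positive integer $N$ and a real number $n$, $G(k,n,N)$ is the maximum, over all $k$-DFAs $D$ with $N$ states, of the number of permutations $w\in S_k$ with $\mathrm{cost}(\mathrm{root}(D),w)\le n$. *)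

(* Defs.v *)
From HB Require Import structures.
From mathcomp Require Import all_boot all_order all_algebra all_fingroup.
From mathcomp Require Import all_classical all_reals all_analysis.

Set Implicit Arguments.
Unset Strict Implicit.
Unset Printing Implicit Defensive.

Import Order.TTheory GRing.Theory Num.Theory.

Local Open Scope ring_scope.

(* The alphabet {1, ..., k} is 'I_k, the ordinal t standing for the letter
   t + 1. *)
Structure dfa (k : nat) := Dfa {
  state : finType;
  delta : state -> 'I_k -> state;
  root : state
}.

(* The strictly positive elements of \bar int are exactly 1, 2, 3, ... and
   +oo. *)
Structure wdfa (k : nat) := WDfa {
  wdfa_dfa :> dfa k;
  cost : state wdfa_dfa -> 'I_k -> \bar int;
  cost_gt0 : forall v t, (0 < cost v t)%E
}.

Definition walk (k : nat) (D : dfa k) (v : state D) (w : seq 'I_k) :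
    seq (state D) :=
  v :: scanl (@delta k D) v w.

(* The walk has one more entry than w; zip drops its last state, so the j-th
   pair is (v_(j-1), w_j). *)
Definition cost_word (k : nat) (D : wdfa k) (v : state D) (w : seq 'I_k) :
    \bar int :=
  (\sum_(p <- zip (walk v w) w) cost p.1 p.2)%E.

(* The successor turns the ordinal pi v t into the letter it stands for. *)
Definition is_kdfa (k : nat) (D : wdfa k) : Prop :=
  forall v : state D, exists pi_v : 'S_k,
    forall t : 'I_k, cost v t = ((pi_v t).+1%:Z)%:E.

Definition perm_word (k : nat) (s : 'S_k) : seq 'I_k :=
  [seq s i | i <- enum 'I_k].

Definition cheap_perms (R : realType) (k : nat) (D : wdfa k) (n : R) :
    {set 'S_k} :=
  [set s : 'S_k |
    (er_map (fun z : int => z%:~R : R) (cost_word (root D) (perm_word s))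
       <= n%:E)%E].

(* At most k! permutations are ever counted, so the attained counts all lie
   in the range of this maximum. *)
Definition G (R : realType) (k : nat) (n : R) (N : nat) : nat :=
  \max_(m < k`!.+1 | `[< exists D : wdfa k,
      [/\ is_kdfa D, #|state D| = N & #|cheap_perms D n| = m] >]) m.

Lemma card_cheap_perms_le (R : realType) (k : nat) (D : wdfa k) (n : R) :
  (#|cheap_perms D n| <= k`!)%N.
Proof. by rewrite -card_Sn; apply/fintype.subset_leq_card/fintype.subsetP => s; rewrite inE. Qed.

Lemma leq_G (R : realType) (k : nat) (n : R) (N : nat) (D : wdfa k) :
  is_kdfa D -> #|state D| = N -> (#|cheap_perms D n| <= G k n N)%N.
Proof.
move=> kD DN; have mk : (#|cheap_perms D n| < k`!.+1)%N.
  by rewrite ltnS card_cheap_perms_le.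
rewrite /G (bigD1 (Ordinal mk)) /= ?leq_maxl//.
by apply/asboolP; exists D.
Qed.

Lemma G_attained (R : realType) (k : nat) (n : R) (N : nat) :
  (0 < N)%N ->
  exists D : wdfa k,
    [/\ is_kdfa D, #|state D| = N & #|cheap_perms D n| = G k n N].
Proof.
case: N => // N _.
pose D0 := @WDfa k (@Dfa k 'I_N.+1 (fun v _ => v) ord0)
  (fun _ t => (t.+1%:Z)%:E) (fun _ _ => isT).
have m0k : (#|cheap_perms D0 n| < k`!.+1)%N.
  by rewrite ltnS card_cheap_perms_le.
pose P (m : 'I_k`!.+1) := `[< exists D : wdfa k,
  [/\ is_kdfa D, #|state D| = N.+1 & #|cheap_perms D n| = m] >].
have P0 : P (Ordinal m0k).
  apply/asboolP; exists D0; split; rewrite ?card_ord//.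
  by move=> v; exists 1%g => t; rewrite perm1.
rewrite /G (bigop.bigmax_eq_arg (Ordinal m0k)) //.
by case: arg_maxnP => // m /asboolP.
Qed.

(* Main.v *)
(* Read off a uniformly random permutation one letter at a time. The letters
   still unread form a uniformly random set of a given size, so by Chernoff
   their mean cost at a fixed state is close to k / 2 outside an event of
   probability exp(- c k); a union bound over the k ^ 2 states and the k times
   makes this hold at every state for all prefixes that leave a positive
   fraction of the letters. While it holds, whatever the current state, the next
   letter has conditional mean cost close to k / 2, so exp(- alpha / k * cost)
   is, up to a constant factor per step, a supermartingale, and Markov's
   inequality bounds the probability that the total cost is small. *)

Require Import Defs.
From HB Require Import structures.
From mathcomp Require Import all_boot all_order all_algebra all_fingroup.
From mathcomp Require Import all_classical all_reals all_analysis.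
From mathcomp Require Import ring lra zify.

Set Implicit Arguments.
Unset Strict Implicit.
Unset Printing Implicit Defensive.

Import Order.TTheory GRing.Theory Num.Theory.

Local Open Scope ring_scope.

(** As [1 + x <= expR x], it suffices that [(1 - x + x ^+ 2) * (1 + x) = 1 + x ^+ 3] is at least
    1. *)
Lemma expRN_le (R : realType) (x : R) :
  0 <= x -> expR (- x) <= 1 - x + x ^+ 2.
Proof.
move=> x0; have h := expR_ge1Dx x.
rewrite expRN -[leLHS]div1r ler_pdivrMr ?expR_gt0 //.
apply: le_trans (ler_wpM2l _ h); nra.
Qed.

(** * Exponential moments of sampling without replacement *)

(** List each set followed by its complement and match the two lists position by position. *)
Lemma exists_perm_imset (T : finType) (A B : {set T}) :
  #|A| = #|B| -> exists t : {perm T}, forall i, (t i \in B) = (i \in A).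
Proof.
move=> AB; pose l (C : {set T}) := enum C ++ enum (~: C).
have lP C : perm_eq (l C) (enum T).
  apply: uniq_perm; rewrite ?enum_uniq //.
    rewrite cat_uniq !enum_uniq andbT /=; apply/hasPn => x.
    by rewrite !mem_enum inE.
  by move=> x; rewrite mem_cat !mem_enum inE orbN.
have lT C x : x \in l C by rewrite (perm_mem (lP C)) mem_enum.
have sl C : size (l C) = #|T| by rewrite (perm_size (lP C)) -cardE.
have ul C : uniq (l C) by rewrite (perm_uniq (lP C)) enum_uniq.
pose f i := nth i (l B) (index i (l A)).
have lt i : (index i (l A) < size (l B))%N by rewrite sl -(sl A) index_mem lT.
have fI : injective f.
  move=> i j; rewrite /f (set_nth_default j i (lt i)) => /eqP.
  rewrite nth_uniq // => /eqP e.
  rewrite -(nth_index i (lT A i)) e (set_nth_default j) ?index_mem //.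
  by rewrite nth_index.
exists (perm fI) => i; rewrite permE /f nth_cat index_cat !mem_enum.
rewrite -cardE -AB; case: (boolP (i \in A)) => iA.
  have h : (index i (enum A) < #|A|)%N by rewrite cardE index_mem mem_enum.
  by rewrite h -mem_enum mem_nth // -cardE -AB.
rewrite -cardE ltnNge leq_addr /= addKn.
have h : (index i (enum (~: A)) < size (enum (~: B)))%N.
  have -> : size (enum (~: B)) = size (enum (~: A)).
    by rewrite -!cardE; have := cardsC A; have := cardsC B; lia.
  by rewrite index_mem mem_enum inE.
by have := mem_nth i h; rewrite mem_enum inE => /negbTE.
Qed.

(** Up to the factor [k ^ k] these are binomial probabilities with mean [m]. The ratio of term
    [j.+1] to term [j] is [(k - j) * m] over [j.+1 * (k - m)], so the terms grow up to [m] and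
    decrease afterwards. *)
Lemma binomial_mode (k m i : nat) : (m <= k)%N -> (i <= k)%N ->
  ('C(k, i) * ((k - m) ^ (k - i) * m ^ i)
     <= 'C(k, m) * ((k - m) ^ (k - m) * m ^ m))%N.
Proof.
move=> mk ik.
pose b j := ('C(k, j) * ((k - m) ^ (k - j) * m ^ j))%N.
(* Writing both terms as multiples of a common [c] avoids dividing by [k - m], which may be zero. *)
have step j : (j < k)%N -> exists c,
    (j.+1 * b j.+1 = (k - j) * m * c /\ j.+1 * b j = j.+1 * (k - m) * c)%N.
  move=> jk; exists ('C(k, j) * ((k - m) ^ (k - j.+1) * m ^ j))%N.
  have e : ((k - m) ^ (k - j) = (k - m) * (k - m) ^ (k - j.+1))%N.
    by rewrite -(subnSK jk) expnS.
  rewrite /b mulnA mul_bin_left e expnS.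
  by split; ring.
have up j : (j < m)%N -> (b j <= b j.+1)%N.
  move=> jm; have [c [e1 e2]] := step j (leq_trans jm mk).
  rewrite -(leq_pmul2l (ltn0Sn j)) e1 e2 leq_mul2r; apply/orP; right.
  by rewrite mulnC leq_mul //; lia.
have down j : (m <= j < k)%N -> (b j.+1 <= b j)%N.
  move=> /andP[mj jk]; have [c [e1 e2]] := step j jk.
  rewrite -(leq_pmul2l (ltn0Sn j)) e1 e2 leq_mul2r; apply/orP; right.
  by rewrite mulnC leq_mul //; lia.
rewrite -/(b i) -/(b m); have [im|mi] := leqP i m.
  rewrite -(subKn im); elim: (m - i)%N => [|d IH]; first by rewrite subn0.
  apply: leq_trans IH; have [dm|dm] := ltnP d m.
    by rewrite -(subnSK dm) up //; lia.
  by have -> : (m - d.+1 = m - d)%N by lia.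
rewrite -(subnKC (ltnW mi)).
have : (i - m <= k - m)%N by lia.
elim: (i - m)%N => [|d IH] dk; first by rewrite addn0.
by apply: leq_trans (IH (ltnW dk)); rewrite addnS down //; lia.
Qed.

Lemma expn_le_binomial_mode (k m : nat) : (m <= k)%N ->
  (k ^ k <= k.+1 * ('C(k, m) * ((k - m) ^ (k - m) * m ^ m)))%N.
Proof.
move=> mk; have := expnDn (k - m) m k; rewrite (subnK mk) => ->.
rewrite -[X in (X * _)%N](card_ord k.+1) -sum_nat_const.
by apply: leq_sum => i _; apply: binomial_mode => //; rewrite -ltnS.
Qed.

(* Sampling without replacement is compared with the random subset of T that
   contains each point independently with probability #|A| / #|T|: it has size
   #|A| with probability at least 1 / (#|T| + 1). *)
Lemma sum_perm_prod_le (R : realType) (T : finType) (x : T -> R)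
    (A : {set T}) :
  (forall t, 0 <= x t) ->
  \sum_(s : {perm T}) \prod_(i in A) x (s i) <=
    #|T|.+1%:R * ((#|T|)`!)%:R
      * expR (#|A|%:R / #|T|%:R * \sum_t (x t - 1)).
Proof.
move=> x0; set k := #|T|; set m := #|A|.
have mk : (m <= k)%N by exact: max_card.
pose M (B : {set T}) := \sum_(s : {perm T}) \prod_(i in B) x (s i).
have M0 B : 0 <= M B by apply: sumr_ge0 => s _; apply: prodr_ge0.
(* By relabelling positions, [M B] depends only on the size of [B]. *)
have ME (B : {set T}) : #|B| = m -> M B = M A.
  move=> /esym/exists_perm_imset[t tP].
  rewrite /M (reindex_inj (mulgI t^-1)%g) /=; apply: eq_bigr => s _.
  rewrite (reindex_inj (@perm_inj _ t)) /=; apply: eq_big => i; rewrite ?tP //.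
  by move=> _; rewrite permM permK.
(* Up to the factor [k ^ k], the probability that the independent random subset is [B]. *)
pose w (B : {set T}) : R := ((k - m) ^ (k - #|B|) * m ^ #|B|)%:R.
have sumc (P : R) : \sum_(s : {perm T}) P = (k`!)%:R * P.
  rewrite sumr_const mulr_natl /k -cardsT -card_perm; congr (_ *+ _).
  by apply: eq_card => s; apply/esym/fintype.subsetP.
have wM : \sum_(B : {set T}) w B * M B
    = (k`!)%:R * \prod_t (m%:R * x t + (k - m)%:R).
  under [LHS]eq_bigr do rewrite mulr_sumr.
  rewrite exchange_big /= -sumc; apply: eq_bigr => s _.
  rewrite (reindex_inj (@perm_inj _ s)) bigA_distr; apply: eq_bigr => B _.
  rewrite [RHS](bigID (fun i => i \in B)) /=.
  rewrite [X in _ = X * _](eq_bigr (fun i => m%:R * x (s i))); last first.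
    by move=> i ->.
  rewrite [X in _ = _ * X](eq_bigr (fun=> (k - m)%:R)); last first.
    by move=> i /negbTE ->.
  rewrite big_split /= !prodr_const.
  rewrite [in X in _ = _ * (_ ^+ X)](eq_card (B := ~: B)) => [|i]; last first.
    by rewrite !inE.
  rewrite [#|~: B|]cardsCs finset.setCK /w natrM !natrX; ring.
have bw : k%:R ^+ k <= k.+1%:R * ('C(k, m)%:R * w A) :> R.
  by rewrite /w -/m -natrX -!natrM ler_nat expn_le_binomial_mode.
have lo : 'C(k, m)%:R * w A * M A <= \sum_(B : {set T}) w B * M B.
  rewrite [leRHS](bigID (fun B : {set T} => #|B| == m)) /=.
  rewrite -[leLHS]addr0 lerD ?sumr_ge0 //; last first.
    by move=> B _; rewrite mulr_ge0 ?ler0n.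
  under eq_bigr => B /eqP Bm do rewrite ME // /w Bm -/m.
  rewrite sumr_const -mulrA -/(w A) mulr_natl.
  rewrite (eq_card (B := [set B : {set T} | #|B| == m])) ?card_draws //.
  by move=> B; rewrite !inE.
(* Each factor is [k * (1 + m / k * (x t - 1))], bounded through [1 + y <= expR y]. *)
have hi : \prod_t (m%:R * x t + (k - m)%:R)
    <= k%:R ^+ k * expR (m%:R / k%:R * \sum_t (x t - 1)).
  rewrite mulr_sumr expR_sum -prodr_const -big_split /=.
  apply: ler_prod => t _; rewrite addr_ge0 ?mulr_ge0 ?ler0n //=.
  have k0 : (0 < k)%N by apply/card_gt0P; exists t.
  apply: le_trans (ler_wpM2l (ler0n _ _) (expR_ge1Dx _)).
  rewrite natrB // mulrDr mulr1 mulrA mulrCA divff ?pnatr_eq0 -?lt0n //.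
  lra.
have kk : 0 < k%:R ^+ k :> R by rewrite -natrX ltr0n expn_gt0; case: (k).
rewrite -(ler_pM2l kk).
apply: (le_trans (ler_wpM2r (M0 A) bw)).
rewrite -[leLHS]mulrA.
apply: (le_trans (ler_wpM2l (ler0n _ _) lo)); rewrite wM.
apply: (le_trans (ler_wpM2l (ler0n _ _) (ler_wpM2l (ler0n _ _) hi))).
by rewrite le_eqVlt; apply/orP; left; apply/eqP; ring.
Qed.

(** * Reading a random permutation letter by letter *)

Lemma mem_take_enum_ord (k j : nat) (i : 'I_k) :
  (i \in take j (enum 'I_k)) = (i < j)%N.
Proof. by rewrite in_take ?mem_enum // index_enum_ord. Qed.

Lemma size_perm_word (k : nat) (s : 'S_k) : size (perm_word s) = k.
Proof. by rewrite size_map size_enum_ord. Qed.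

Lemma uniq_perm_word (k : nat) (s : 'S_k) : uniq (perm_word s).
Proof. by rewrite map_inj_uniq ?enum_uniq //; exact: perm_inj. Qed.

Lemma mem_take_perm_word (k j : nat) (s : 'S_k) (i : 'I_k) :
  (s i \in take j (perm_word s)) = (i < j)%N.
Proof.
rewrite -map_take mem_map; last exact: perm_inj.
exact: mem_take_enum_ord.
Qed.

Lemma take_perm_word_tperm (k j : nat) (s : 'S_k) (a b : 'I_k) :
  (j <= a)%N -> (j <= b)%N ->
  take j (perm_word (tperm a b * s)%g) = take j (perm_word s).
Proof.
move=> ja jb; rewrite -[LHS]map_take -[RHS]map_take; apply/eq_in_map => x xin.
have xj : (x < j)%N by rewrite -mem_take_enum_ord; exact: xin.
by rewrite permM tpermD //; apply/eqP => e; move: xj; rewrite -e ltnNge ?ja ?jb.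
Qed.

(* Composing with the transposition of the positions j and i >= j leaves the
   prefix of length j unchanged, so the letter at position j is exchangeable
   with every later one. *)
Lemma sum_perm_word_next (R : realType) (k j : nat) (jk : (j < k)%N)
    (F : seq 'I_k -> 'I_k -> R) :
  (k - j)%:R * (\sum_s F (take j (perm_word s)) (s (Ordinal jk))) =
  \sum_s \sum_(t | t \notin take j (perm_word s)) F (take j (perm_word s)) t.
Proof.
have sumc (x : R) : \sum_(i < k | (j <= i)%N) x = (k - j)%:R * x.
  have := big_geq_mkord j k xpredT (fun=> x) (idx := 0) (op := +%R).
  by rewrite sumr_const_nat mulr_natl => ->.
rewrite -sumc.
rewrite exchange_big /=.
transitivity (\sum_s \sum_(i < k | (j <= i)%N) F (take j (perm_word s)) (s i)).
  rewrite exchange_big [RHS]exchange_big /=; apply: eq_bigr => i ji.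
  rewrite (reindex_inj (mulgI (tperm (Ordinal jk) i))%g) /=.
  by apply: eq_bigr => s _; rewrite take_perm_word_tperm // permM tpermL.
apply: eq_bigr => s _; rewrite [RHS](reindex_inj (@perm_inj _ s)) /=.
by apply: eq_bigl => i; rewrite mem_take_perm_word -leqNgt.
Qed.

(** The unread letters being equally likely to come next, the hypothesis bounds the conditional mean
    of [g] after one more letter by [rho] times its present value; this is iterated [J] times. *)
Lemma sum_perm_word_supermartingale (R : realType) (k J : nat) (rho : R)
    (g : seq 'I_k -> R) :
  0 <= rho -> (J <= k)%N ->
  (forall u, uniq u -> (size u < J)%N ->
     \sum_(t | t \notin u) g (rcons u t) <= (k - size u)%:R * (rho * g u)) ->
  \sum_(s : 'S_k) g (take J (perm_word s)) <= (k`!)%:R * (rho ^+ J * g [::]).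
Proof.
move=> rho0; elim: J => [|j IH] jk step.
  under eq_bigr do rewrite take0.
  rewrite sumr_const expr0 mul1r mulr_natl.
  by rewrite card_Sn.
have le_j : \sum_(s : 'S_k) g (take j (perm_word s))
    <= (k`!)%:R * (rho ^+ j * g [::]).
  by apply: IH (ltnW jk) _ => u uu uj; apply: step (ltnW uj).
have kj : 0 < (k - j)%:R :> R by rewrite ltr0n subn_gt0.
have takeS (s : 'S_k) : take j.+1 (perm_word s)
    = rcons (take j (perm_word s)) (s (Ordinal jk)).
  rewrite (take_nth (Ordinal jk)) ?size_perm_word //; congr rcons.
  rewrite (nth_map (Ordinal jk)) ?size_enum_ord //.
  by rewrite (nth_ord_enum _ (Ordinal jk)).
under eq_bigr do rewrite takeS.
rewrite -(ler_pM2l kj) (sum_perm_word_next jk (fun u t => g (rcons u t))).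
apply: (@le_trans _ _
  (\sum_s (k - j)%:R * (rho * g (take j (perm_word s))))).
  apply: ler_sum => s _.
  have sj : size (take j (perm_word s)) = j.
    by rewrite size_takel // size_perm_word ltnW.
  have := step (take j (perm_word s)); rewrite sj; apply => //.
  by rewrite take_uniq ?uniq_perm_word.
rewrite -!mulr_sumr ler_pM2l // exprS.
have := ler_wpM2l rho0 le_j; lra.
Qed.

(** * Finite word costs and balanced prefixes *)

Definition word_cost (k : nat) (D : dfa k) (c : state D -> 'I_k -> nat)
    (v : state D) (w : seq 'I_k) : nat :=
  \sum_(p <- zip (walk v w) w) c p.1 p.2.

Lemma word_cost_cons (k : nat) (D : dfa k) (c : state D -> 'I_k -> nat)
    (v : state D) (t : 'I_k) (w : seq 'I_k) :
  word_cost c v (t :: w) = (c v t + word_cost c (delta v t) w)%N.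
Proof. by rewrite /word_cost /= big_cons. Qed.

Lemma word_cost_cat (k : nat) (D : dfa k) (c : state D -> 'I_k -> nat)
    (v : state D) (w1 w2 : seq 'I_k) :
  word_cost c v (w1 ++ w2)
    = (word_cost c v w1 + word_cost c (foldl (@delta k D) v w1) w2)%N.
Proof.
elim: w1 v => [|t w1 IH] v /=.
  by rewrite [X in (X + _)%N]/word_cost big_nil.
by rewrite !word_cost_cons IH addnA.
Qed.

Lemma word_cost_take (k : nat) (D : dfa k) (c : state D -> 'I_k -> nat)
    (v : state D) (w : seq 'I_k) (j : nat) :
  (word_cost c v (take j w) <= word_cost c v w)%N.
Proof. by rewrite -{2}(cat_take_drop j w) word_cost_cat leq_addr. Qed.

Lemma cost_word_kdfa (k : nat) (D : wdfa k) (c : state D -> 'I_k -> nat)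
    (v : state D) (w : seq 'I_k) :
  (forall v t, cost v t = ((c v t)%:Z)%:E) ->
  cost_word v w = ((word_cost c v w)%:Z)%:E.
Proof.
move=> costE; rewrite /cost_word /word_cost.
elim: (zip _ _) => [|q r IH]; first by rewrite !big_nil.
by rewrite !big_cons IH costE -EFinD.
Qed.

(** For [u] without repetition, the unread letters have mean cost at least [beta * k] at [v]. Only a
    lower bound is asked, since the event to be controlled is a low total cost. *)
Definition balanced (R : realType) (k : nat) (D : dfa k)
    (c : state D -> 'I_k -> nat) (beta : R) (v : state D) (u : seq 'I_k) :
    bool :=
  (k - size u)%:R * (beta * k%:R) <= \sum_(t | t \notin u) (c v t)%:R.

(** Only proper prefixes are tested, so each test is settled before the next letter is read. All
    states are tested, because the state reached depends on the letters read whereas the Chernoff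
    bound needs a fixed state. *)
Definition prefixes_balanced (R : realType) (k : nat) (D : dfa k)
    (c : state D -> 'I_k -> nat) (beta : R) (u : seq 'I_k) : bool :=
  all (fun j => [forall v, balanced c beta v (take j u)]) (iota 0 (size u)).

Lemma prefixes_balanced_rcons (R : realType) (k : nat) (D : dfa k)
    (c : state D -> 'I_k -> nat) (beta : R) (u : seq 'I_k) (t : 'I_k) :
  prefixes_balanced c beta (rcons u t)
    = prefixes_balanced c beta u && [forall v, balanced c beta v u].
Proof.
rewrite /prefixes_balanced size_rcons -addn1 iotaD all_cat /= andbT add0n.
congr andb.
  apply: eq_in_all => j; rewrite mem_iota /= add0n => ju.
  by rewrite -cats1 takel_cat // ltnW.
by rewrite -cats1 take_size_cat.
Qed.

(** * Supermartingale and Chernoff estimates *)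

Lemma expRN_cost_le (R : realType) (k c : nat) (alpha : R) :
  (0 < k)%N -> 0 <= alpha -> (c <= k)%N ->
  expR (- (alpha / k%:R * c%:R)) <= 1 + alpha ^+ 2 - alpha / k%:R * c%:R.
Proof.
move=> k0 a0 ck; have k0' : 0 < k%:R :> R by rewrite ltr0n.
have x0 : 0 <= alpha / k%:R * c%:R by rewrite mulr_ge0 // divr_ge0.
have xa : alpha / k%:R * c%:R <= alpha.
  by rewrite mulrAC ler_pdivrMr // ler_wpM2l // ler_nat.
apply: le_trans (expRN_le x0) _.
have : (alpha / k%:R * c%:R) ^+ 2 <= alpha ^+ 2 by rewrite lerXn2r ?nnegrE.
lra.
Qed.

Lemma card_notin_seq (T : finType) (u : seq T) :
  uniq u -> #|[pred t | t \notin u]| = (#|T| - size u)%N.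
Proof. by move=> uu; rewrite -(card_uniqP uu) -(cardC (mem u)) addKn. Qed.

(** The indicator kills the process after an unbalanced prefix. Until then one more letter
    multiplies the conditional mean by at most [1 + alpha ^+ 2 - alpha * beta], hence by at most the
    exponential of [alpha ^+ 2 - alpha * beta]. *)
Lemma sum_prefixes_balanced_le (R : realType) (k J : nat) (D : dfa k)
    (c : state D -> 'I_k -> nat) (alpha beta : R) :
  (0 < k)%N -> (J <= k)%N -> 0 <= alpha -> (forall v t, (c v t <= k)%N) ->
  \sum_(s : 'S_k) (prefixes_balanced c beta (take J (perm_word s)))%:R
      * expR (- (alpha / k%:R
          * (word_cost c (Defs.root D) (take J (perm_word s)))%:R))
    <= (k`!)%:R * expR (J%:R * (alpha ^+ 2 - alpha * beta)).
Proof.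
move=> k0 Jk a0 ck; have k0' : 0 < k%:R :> R by rewrite ltr0n.
pose g (u : seq 'I_k) : R := (prefixes_balanced c beta u)%:R
  * expR (- (alpha / k%:R * (word_cost c (Defs.root D) u)%:R)).
have g0 : g [::] = 1.
  rewrite /g /prefixes_balanced /= /word_cost big_nil.
  by rewrite mulr0 oppr0 expR0 mulr1.
have -> : expR (J%:R * (alpha ^+ 2 - alpha * beta))
    = expR (alpha ^+ 2 - alpha * beta) ^+ J * g [::].
  by rewrite g0 mulr1 -expRM_natl mulr_natl.
apply: (sum_perm_word_supermartingale (g := g)) => //.
move=> u uu uJ; pose v := foldl (@delta k D) (Defs.root D) u.
have gS t : g (rcons u t) = [forall v, balanced c beta v u]%:R
    * g u * expR (- (alpha / k%:R * (c v t)%:R)).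
  rewrite /g prefixes_balanced_rcons -cats1 word_cost_cat -/v word_cost_cons.
  rewrite /word_cost big_nil addn0 natrD mulrDr opprD expRD.
  by rewrite -mulnb natrM; ring.
under eq_bigr do rewrite gS.
rewrite -mulr_sumr.
have gu0 : 0 <= g u by rewrite mulr_ge0 ?ler0n ?expR_ge0.
(* Balance is used only at the state [v] reached by [u]; if it fails at some state, the left side is
   zero. *)
case: forallP => [/(_ v) bal|_]; last first.
  by rewrite !mul0r !mulr_ge0 ?ler0n ?expR_ge0.
rewrite mul1r mulrA [leRHS]mulrC ler_wpM2l //.
apply: (@le_trans _ _
  ((k - size u)%:R * (1 + (alpha ^+ 2 - alpha * beta)))).
  apply: (@le_trans _ _ (\sum_(t | t \notin u)
      (1 + alpha ^+ 2 - alpha / k%:R * (c v t)%:R))).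
    by apply: ler_sum => t _; apply: expRN_cost_le.
  rewrite sumrB -mulr_sumr sumr_const card_notin_seq // card_ord.
  have ak : 0 <= alpha / k%:R by rewrite divr_ge0.
  have := ler_wpM2l ak bal; rewrite -[(1 + alpha ^+ 2) *+ _]mulr_natl.
  have -> : alpha / k%:R * ((k - size u)%:R * (beta * k%:R))
     = (k - size u)%:R * (alpha * beta) by field; rewrite lt0r_neq0.
  lra.
by rewrite ler_wpM2l ?ler0n // expR_ge1Dx.
Qed.

(** Chernoff's bound for one state and one prefix length. The unread letters are the images of the
    positions from [j] on; the factor [k.+1] is the price of comparing with independent sampling. *)
Lemma card_unbalanced_le (R : realType) (k j : nat) (D : dfa k)
    (c : state D -> 'I_k -> nat) (alpha beta : R) (v : state D) :
  (0 < k)%N -> (j <= k)%N -> 0 <= alpha -> (forall v t, (c v t <= k)%N) ->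
  (k ^ 2 <= 2 * \sum_t c v t)%N ->
  \sum_(s : 'S_k) (~~ balanced c beta v (take j (perm_word s)))%:R
    <= k.+1%:R * (k`!)%:R
       * expR ((k - j)%:R * (alpha * (beta - 1 / 2 + alpha))) :> R.
Proof.
move=> k0 jk a0 ck mean; have k0' : 0 < k%:R :> R by rewrite ltr0n.
pose x t : R := expR (- (alpha / k%:R * (c v t)%:R)).
pose A := [set i : 'I_k | (j <= i)%N].
have cA : #|A| = (k - j)%N.
  rewrite -sum1_card.
  have := big_geq_mkord j k xpredT (fun=> 1%N) (idx := 0%N) (op := addn).
  by rewrite sum_nat_const_nat muln1 => ->; apply: eq_bigl => i; rewrite inE.
have := sum_perm_prod_le A (fun t => expR_ge0 (- (alpha / k%:R * (c v t)%:R))).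
rewrite -/x card_ord cA => chernoff.
(* The term [alpha / 2] comes from [mean]: over all letters the mean cost at [v] is at least
   [k / 2]. *)
have sumx : \sum_t (x t - 1) <= k%:R * (alpha ^+ 2 - alpha / 2).
  apply: (@le_trans _ _ (\sum_t (alpha ^+ 2 - alpha / k%:R * (c v t)%:R))).
    apply: ler_sum => t _; have := expRN_cost_le k0 a0 (ck v t).
    rewrite -/(x t); lra.
  rewrite sumrB -[X in _ - X <= _]mulr_sumr sumr_const card_ord.
  rewrite -[alpha ^+ 2 *+ _]mulr_natl -natr_sum.
  have : k%:R ^+ 2 <= 2 * (\sum_t c v t)%:R :> R.
    by rewrite -natrX -natrM ler_nat.
  move=> h; have ak : 0 <= alpha / k%:R / 2 by rewrite !divr_ge0.
  have := ler_wpM2l ak h.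
  have -> : alpha / k%:R / 2 * k%:R ^+ 2 = k%:R * (alpha / 2).
    by field; rewrite lt0r_neq0.
  have -> : alpha / k%:R / 2 * (2 * (\sum_t c v t)%:R)
    = alpha / k%:R * (\sum_t c v t)%:R.
    by field; rewrite lt0r_neq0.
  lra.
pose e := (k - j)%:R * (alpha * beta).
(* Markov's inequality pointwise: when balance fails, the right side is at least 1. *)
have bad s : (~~ balanced c beta v (take j (perm_word s)))%:R
    <= expR e * \prod_(i in A) x (s i).
  case: (boolP (balanced _ _ _ _)) => [_|] /=.
    by rewrite mulr_ge0 ?expR_ge0 // prodr_ge0 // => i _; exact: expR_ge0.
  rewrite /balanced size_takel ?size_perm_word // -ltNge => lt.
  rewrite -expR_sum -expRD -[leLHS]expR0 ler_expR sumrN -mulr_sumr.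
  rewrite (reindex_inj (@perm_inj _ s)) /= in lt.
  rewrite (eq_bigl (fun i => i \in A)) in lt; last first.
    by move=> i; rewrite mem_take_perm_word -leqNgt !inE.
  have ak : 0 <= alpha / k%:R by rewrite divr_ge0.
  have := ler_wpM2l ak (ltW lt).
  have -> : alpha / k%:R * ((k - j)%:R * (beta * k%:R)) = e.
    by rewrite /e; field; rewrite lt0r_neq0.
  lra.
apply: (le_trans (ler_sum _ (fun s _ => bad s))).
rewrite -mulr_sumr.
apply: (le_trans (ler_wpM2l (expR_ge0 _) chernoff)).
rewrite mulrCA ler_wpM2l ?mulr_ge0 ?ler0n // -expRD ler_expR /e.
have mk : 0 <= (k - j)%:R / k%:R :> R by rewrite divr_ge0 ?ler0n.
have := ler_wpM2l mk sumx.
have -> : (k - j)%:R / k%:R * (k%:R * (alpha ^+ 2 - alpha / 2))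
  = (k - j)%:R * (alpha ^+ 2 - alpha / 2) by field; rewrite lt0r_neq0.
lra.
Qed.

(** * Counting cheap permutations *)

(** The first term is Markov's inequality for permutations whose prefixes shorter than [J] are all
    balanced; the second is the union bound over states and lengths [j < J]. *)
Lemma card_low_cost_le (R : realType) (k J : nat) (D : dfa k)
    (c : state D -> 'I_k -> nat) (alpha beta n : R) :
  (0 < k)%N -> (J <= k)%N -> 0 <= alpha -> (forall v t, (c v t <= k)%N) ->
  (forall v, k ^ 2 <= 2 * \sum_t c v t)%N ->
  #|[set s : 'S_k | (word_cost c (Defs.root D) (perm_word s))%:R <= n]|%:R
    <= (k`!)%:R * (expR (alpha * n / k%:R + J%:R * (alpha ^+ 2 - alpha * beta))
        + (#|state D| * k.+1)%:R * \sum_(j < J)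
            expR ((k - j)%:R * (alpha * (beta - 1 / 2 + alpha)))).
Proof.
move=> k0 Jk a0 ck mean; have ak : 0 <= alpha / k%:R by rewrite divr_ge0.
pose g (s : 'S_k) : R := (prefixes_balanced c beta (take J (perm_word s)))%:R
  * expR (- (alpha / k%:R
      * (word_cost c (Defs.root D) (take J (perm_word s)))%:R)).
pose b (s : 'S_k) (j : 'I_J) v : R :=
  (~~ balanced c beta v (take j (perm_word s)))%:R.
have g0 s : 0 <= g s by rewrite mulr_ge0 ?ler0n ?expR_ge0.
have pt s : (word_cost c (Defs.root D) (perm_word s))%:R <= n ->
    1 <= expR (alpha * n / k%:R) * g s + \sum_j \sum_v b s j v.
  move=> sn; rewrite /g; case: (boolP (prefixes_balanced _ _ _)) => [_|].
    rewrite mul1r -expRD -[leLHS]addr0 lerD ?sumr_ge0 // => [|j _]; last first.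
      by apply: sumr_ge0 => v _; rewrite ler0n.
    rewrite -[leLHS]expR0 ler_expR subr_ge0 [leRHS]mulrAC ler_wpM2l //.
    (* The weight sees only the first [J] letters, which cost no more than the whole word. *)
    by apply: le_trans sn; rewrite ler_nat word_cost_take.
  rewrite mul0r mulr0 add0r => /allPn[j]; rewrite mem_iota /= add0n.
  rewrite size_takel ?size_perm_word // => jJ.
  rewrite (take_takel _ (ltnW jJ)) negb_forall => /existsP[v bv].
  rewrite (bigD1 (Ordinal jJ)) //= (bigD1 v) //= {1}/b bv -addrA lerDl.
  apply: addr_ge0; apply: sumr_ge0 => i _; first exact: ler0n.
  by apply: sumr_ge0 => w _; exact: ler0n.
rewrite -sum1_card natr_sum.
apply: (@le_trans _ _ (\sum_(s : 'S_k)
    (expR (alpha * n / k%:R) * g s + \sum_j \sum_v b s j v))).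
  rewrite [leRHS](bigID (mem [set s : 'S_k |
    (word_cost c (Defs.root D) (perm_word s))%:R <= n])) /= -[leLHS]addr0.
  apply: lerD; first by apply: ler_sum => s; rewrite inE; exact: pt.
  apply: sumr_ge0 => s _; rewrite addr_ge0 ?mulr_ge0 ?expR_ge0 //.
  by apply: sumr_ge0 => j _; apply: sumr_ge0 => v _; rewrite ler0n.
rewrite big_split /= -mulr_sumr mulrDr; apply: lerD.
  rewrite expRD mulrCA ler_wpM2l ?expR_ge0 //.
  exact: sum_prefixes_balanced_le.
rewrite exchange_big /= mulrA mulr_sumr; apply: ler_sum => j _.
rewrite exchange_big /=.
apply: (@le_trans _ _ (\sum_(v : state D) k.+1%:R * (k`!)%:R
       * expR ((k - j)%:R * (alpha * (beta - 1 / 2 + alpha))))).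
  apply: ler_sum => v _; apply: card_unbalanced_le => //.
  by apply: leq_trans Jk; apply: ltnW.
rewrite sumr_const -[leLHS]mulr_natl natrM.
by rewrite le_eqVlt; apply/orP; left; apply/eqP; ring.
Qed.

(** * Numerical estimates and choice of constants *)

Lemma leq_sum_perm_succ (k : nat) (p : 'S_k) :
  (k ^ 2 <= 2 * \sum_t (p t).+1)%N.
Proof.
have -> : \sum_t (p t).+1 = \sum_(i < k) i.+1.
  by rewrite [RHS](reindex_inj (@perm_inj _ p)).
elim: k {p} => [|k IH] //; rewrite big_ord_recr /=.
rewrite mulnDr; apply: leq_trans (leq_add IH (leqnn _)).
by rewrite -addn1 sqrnD; lia.
Qed.

(** The left side is at most [3 * k ^ 4], while [expR (eta * k)] is the fifth power of
    [expR (eta / 5 * k)], hence at least [(eta / 5 * k) ^ 5]. *)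
Lemma quartic_le_expR (R : realType) (eta : R) : 0 < eta ->
  exists k0 : nat, forall k : nat, (0 < k)%N -> (k0 <= k)%N ->
    1 + (k ^ 3 * k.+1)%:R <= expR (eta * k%:R).
Proof.
move=> eta0; exists (Num.trunc (3 * (5 / eta) ^+ 5)).+1 => k k0 lek.
have k0' : 1 <= k%:R :> R by rewrite ler1n.
have big : 3 * (5 / eta) ^+ 5 <= k%:R.
  by apply: le_trans (ltW (truncnS_gt _)) _; rewrite ler_nat.
have -> : eta * k%:R = 5%:R * (eta / 5 * k%:R) by field.
rewrite expRM_natl.
apply: (@le_trans _ _ ((eta / 5 * k%:R) ^+ 5)); last first.
  rewrite lerXn2r ?nnegrE ?expR_ge0 //.
    by rewrite !mulr_ge0 ?invr_ge0 // ltW.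
  by apply: le_trans (expR_ge1Dx _); rewrite lerDr.
rewrite exprMn [X in _ * X]exprS mulrA.
apply: (@le_trans _ _ (3 * k%:R ^+ 4)).
  rewrite natrM natrX -natr1; have : 1 <= k%:R ^+ 3 :> R by rewrite exprn_ege1.
  have -> : k%:R ^+ 4 = k%:R ^+ 3 * k%:R :> R by rewrite exprSr.
  nra.
rewrite ler_wpM2r ?exprn_ge0 //.
have e5 : 0 <= (eta / 5) ^+ 5 by rewrite exprn_ge0 // divr_ge0 // ltW.
have := ler_wpM2l e5 big.
have -> // : (eta / 5) ^+ 5 * (3 * (5 / eta) ^+ 5) = 3.
by rewrite mulrCA -exprMn; field; rewrite lt0r_neq0.
Qed.

Theorem theorem2 (R : realType) (eps : R) (heps : 0 < eps) :
  exists c : R, 0 < c /\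
    exists k0 : nat, forall k : nat, (0 < k)%N -> (k0 <= k)%N ->
      (G k ((1 / 2 - eps) * k%:R ^+ 2) (k ^ 2)%N)%:R
        <= expR (- c * k%:R) * (k`!)%:R.
Proof.
(* A smaller [e] only raises the cost threshold; [e <= 1 / 4] keeps the coefficients below
   nonnegative. *)
have [e [e0 e4 le_eps]] : exists e : R, [/\ 0 < e, e <= 1 / 4 & e <= eps].
  exists (Num.min eps (1 / 4)); split; last by rewrite ge_min lexx.
    by rewrite lt_min heps /=; lra.
  by rewrite ge_min lexx orbT.
(* The union-bound rate: at least [e / 4 * k] unread letters, each contributing [e ^+ 2 / 64]. *)
pose eta := e ^+ 3 / 256.
have eta0 : 0 < eta by rewrite divr_gt0 // exprn_gt0.
have eta2 : 0 < eta / 2 by rewrite divr_gt0.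
have eta_le : eta <= e ^+ 2 / 16 by rewrite /eta; nra.
(* The other half of [eta] absorbs the polynomial factor. *)
exists (eta / 2); split=> //.
have [k0 k0P] := quartic_le_expR eta2.
exists k0 => k k_gt0 le_k; have k0' : 0 < k%:R :> R by rewrite ltr0n.
set n := (1 / 2 - eps) * _.
have [|D [kD cardD <-]] := @G_attained R k n (k ^ 2).
  by rewrite expn_gt0 k_gt0.
have [p pE] := boolp.choice kD.
pose c v t := (p v t).+1.
have ck v t : (c v t <= k)%N by exact: ltn_ord.
have mean v : (k ^ 2 <= 2 * \sum_t c v t)%N by exact: leq_sum_perm_succ.
have -> : cheap_perms D n
    = [set s | (word_cost c (Defs.root D) (perm_word s))%:R <= n].
  apply/setP => s; rewrite !inE (cost_word_kdfa _ _ pE) /=.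
  by rewrite lee_fin -pmulrn.
(* The successor gives [J >= (1 - e / 4) * k], while every [j < J] still satisfies
   [j <= (1 - e / 4) * k]. *)
pose J := (Num.trunc ((1 - e / 4) * k%:R)).+1.
have x0 : 0 <= (1 - e / 4) * k%:R by rewrite mulr_ge0 // ?ltW //; lra.
have Jk : (J <= k)%N by rewrite /J truncn_lt_nat //; nra.
have leJ : (1 - e / 4) * k%:R <= J%:R by exact: ltW (truncnS_gt _).
have ltJ j : (j < J)%N -> e / 4 * k%:R <= (k - j)%:R.
  move=> jJ; rewrite natrB; last exact: ltnW (leq_trans jJ Jk).
  have : j%:R <= (1 - e / 4) * k%:R by rewrite -truncn_ge_nat.
  lra.
have a0 : 0 <= e / 8 by lra.
(* With [beta = 1 / 2 - e / 4], the Chernoff rate [alpha * (alpha - e / 4)] is least at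
   [alpha = e / 8]. *)
have := card_low_cost_le (1 / 2 - e / 4) n k_gt0 Jk a0 ck mean.
move/le_trans; apply; rewrite mulrC ler_wpM2r ?ler0n // cardD.
(* The polynomial collects [k ^ 2] states, the factor [k.+1] and at most [k] lengths. *)
apply: (@le_trans _ _ (expR (- eta * k%:R) * (1 + (k ^ 3 * k.+1)%:R))).
  rewrite [leRHS]mulrDr mulr1; apply: lerD.
    (* This exponent is at most [- e ^+ 2 / 16 * k], so [eta_le] suffices. *)
    rewrite ler_expR /n.
    have -> : e / 8 * ((1 / 2 - eps) * k%:R ^+ 2) / k%:R
      = e / 8 * (1 / 2 - eps) * k%:R by field; rewrite lt0r_neq0.
    have h1 : (1 / 2 - eps) * (e / 8 * k%:R) <= (1 / 2 - e) * (e / 8 * k%:R).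
      by rewrite ler_wpM2r ?mulr_ge0 ?ler0n //; lra.
    have h2 : 0 <= (e / 8) * (1 / 2 - e / 4 - e / 8).
      by rewrite mulr_ge0 //; lra.
    have := ler_wpM2r h2 leJ; have := ler_wpM2r (ltW k0') eta_le.
    have : 0 <= e ^+ 3 * k%:R by rewrite mulr_ge0 ?exprn_ge0 // ltW.
    lra.
  have -> : (k ^ 3 * k.+1)%:R = (k ^ 2 * k.+1)%:R * k%:R :> R.
    by rewrite -natrM; congr (_%:R); ring.
  rewrite [leRHS]mulrCA ler_wpM2l ?ler0n //.
  apply: (@le_trans _ _ (\sum_(j < J) expR (- eta * k%:R))).
    apply: ler_sum => j _; rewrite ler_expR.
    have e2 : 0 <= e ^+ 2 / 64 by rewrite divr_ge0 ?exprn_ge0 // ltW.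
    have := ler_wpM2r e2 (ltJ j (ltn_ord j)); rewrite /eta; lra.
  rewrite sumr_const card_ord -[leLHS]mulr_natr ler_wpM2l ?expR_ge0 //.
  by rewrite ler_nat.
have -> : - (eta / 2) * k%:R = - eta * k%:R + eta / 2 * k%:R by field.
by rewrite expRD ler_wpM2l ?expR_ge0 // k0P.
Qed.
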